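(* For any integers $n, m \geq 3$, the super edge-magic deficiency of $P_n + \overline{K_m}$ satisfies \[\left\lceil \tfrac{1}{2}(n-2)(m-1)\right\rceil \leq \mu_s(P_n + \overline{K_m}) \leq (n-1)(m-1)-1.\]
   Context: All graphs are finite and simple. For a graph $G$ with $p=|V(G)|$ vertices and $q=|E(G)|$ edges, a super edge-magic labeling is a bijection $f: V(G)\cup E(G)\to\{1,2,\ldots,p+q\}$ with $f(V(G))=\{1,\ldots,p\}$ such that $f(x)+f(xy)+f(y)$ is the same constant for every edge $xy$; $G$ is super edge-magic if it has such a labeling. The super edge-magic deficiency $\mu_s(G)$ is the minimum nonnegative integer $t$ such that $G\cup tK_1$ (disjoint union of $G$ with $t$ isolated vertices) is super edge-magic, or $+\infty$ if no such $t$ exists. The join $G_1+G_2$ of two vertex-disjoint graphs is their union together with all edges joining a vertex of $G_1$ to a vertex of $G_2$. $P_n$ is the path on $n$ vertices and $\overline{K_m}$ is the graph with $m$ vertices and no edges; so $P_n+\overline{K_m}$ has vertices $u_1,\ldots,u_n,v_1,\ldots,v_m$ and edges $u_iu_{i+1}$ ($1\le i\le n-1$) and $u_iv_j$ ($1\le i\le n$, $1\le j\le m$). *)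

(* Defs.v *)
From mathcomp Require Import all_boot all_order all_algebra.
From mathcomp Require Import boolp constructive_ereal.

Set Implicit Arguments.
Unset Strict Implicit.
Unset Printing Implicit Defensive.

Record sgraph := SGraph {
  vertex :> finType;
  adj : rel vertex;
  adj_sym : symmetric adj;
  adj_irrefl : irreflexive adj }.

Definition edges (G : sgraph) : {set {set G}} :=
  [set [set p.1; p.2] | p : G * G & adj p.1 p.2].

Definition edge (G : sgraph) : finType := {e : {set G} | e \in edges G}.

Definition empty_rel (T : finType) : rel T := fun _ _ => false.

Lemma empty_rel_sym (T : finType) : symmetric (@empty_rel T).
Proof. by []. Qed.

Lemma empty_rel_irrefl (T : finType) : irreflexive (@empty_rel T).
Proof. by []. Qed.

(* The complement of K_m, which is also m K_1 *)
Definition empty_graph (m : nat) : sgraph :=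
  SGraph (@empty_rel_sym 'I_m) (@empty_rel_irrefl 'I_m).

Definition path_rel (n : nat) : rel 'I_n :=
  fun i j => (i.+1 == j :> nat) || (j.+1 == i :> nat).

Lemma path_rel_sym n : symmetric (@path_rel n).
Proof. by move=> i j; rewrite /path_rel orbC. Qed.

Lemma path_rel_irrefl n : irreflexive (@path_rel n).
Proof. by move=> i; rewrite /path_rel orbb gtn_eqF. Qed.

Definition path_graph (n : nat) : sgraph :=
  SGraph (@path_rel_sym n) (@path_rel_irrefl n).

(* [across] tells whether the two parts are completely joined or not at all *)
Definition sum_rel (across : bool) (G1 G2 : sgraph) : rel (G1 + G2)%type :=
  fun x y => match x, y with
    | inl a, inl b => adj a b
    | inr a, inr b => adj a b
    | _, _ => across
    end.

Lemma sum_rel_sym b G1 G2 : symmetric (@sum_rel b G1 G2).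
Proof. by move=> [x|x] [y|y] //=; rewrite adj_sym. Qed.

Lemma sum_rel_irrefl b G1 G2 : irreflexive (@sum_rel b G1 G2).
Proof. by move=> [x|x] /=; rewrite adj_irrefl. Qed.

Definition disjoint_union (G1 G2 : sgraph) : sgraph :=
  SGraph (@sum_rel_sym false G1 G2) (@sum_rel_irrefl false G1 G2).

Definition join_graph (G1 G2 : sgraph) : sgraph :=
  SGraph (@sum_rel_sym true G1 G2) (@sum_rel_irrefl true G1 G2).

Definition super_edge_magic_labeling (G : sgraph) (f : G + edge G -> nat) : Prop :=
  [/\ injective f,
      forall k, (exists z, f z = k) <-> 1 <= k <= #|G| + #|edges G|,
      forall k, (exists x : G, f (inl x) = k) <-> 1 <= k <= #|G|
    & exists c : nat, forall (x y : G) (e : edge G),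
        val e = [set x; y] -> f (inl x) + f (inr e) + f (inl y) = c].

Definition super_edge_magic (G : sgraph) : Prop :=
  exists f : G + edge G -> nat, super_edge_magic_labeling f.

Definition sem_with_isolated (G : sgraph) : pred nat :=
  fun t => `[< super_edge_magic (disjoint_union G (empty_graph t)) >].

Definition sem_deficiency (G : sgraph) : \bar int :=
  match pselect (exists t, sem_with_isolated G t) with
  | left ex => ((ex_minn ex)%:Z)%:E
  | right _ => +oo%E
  end.

(* Main.v *)
(* A vertex numbering of G by 1..p extends to a super edge-magic labeling iff
   the edge sums are q = |E(G)| consecutive integers.  Distinct sums lie
   between 3 and 2p-1, so q <= 2p-3, which is the lower bound.  For the upper
   bound p = nm, label v_1 by 1 and v_j by nj for j >= 2, and label the path
   with floor(n/2)+1, ..., floor(n/2)+n, alternately from the lower and the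
   upper half.  The sums at v_1, then those along the path, then those at
   v_2, ..., v_m fill consecutive blocks of integers. *)
Require Import Defs.
From mathcomp Require Import all_boot all_order all_algebra.
From mathcomp Require Import boolp constructive_ereal.
From mathcomp Require Import zify lra.

Set Implicit Arguments.
Unset Strict Implicit.
Unset Printing Implicit Defensive.

(** * Edges and the sums of vertex labels over them *)

Definition edge_sum (G : sgraph) (g : G -> nat) (e : {set G}) : nat :=
  \sum_(x in e) g x.

Lemma adj_neq (G : sgraph) (x y : G) : adj x y -> x != y.
Proof. by apply: contraTneq => ->; rewrite adj_irrefl. Qed.

Lemma edge_sum_pair (G : sgraph) (g : G -> nat) (x y : G) :
  x != y -> edge_sum g [set x; y] = g x + g y.
Proof. by move=> xy; rewrite /edge_sum big_setU1 ?inE // big_set1. Qed.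

Lemma edgesP (G : sgraph) (e : {set G}) :
  reflect (exists x y, adj x y /\ e = [set x; y]) (e \in edges G).
Proof.
apply: (iffP imsetP) => [[[x y] + ->]|[x [y [xy ->]]]].
  by rewrite inE => xy; exists x, y.
by exists (x, y); rewrite ?inE.
Qed.

Lemma mem_edges (G : sgraph) (x y : G) : adj x y -> [set x; y] \in edges G.
Proof. by move=> xy; apply/edgesP; exists x, y. Qed.

(** The magic condition ranges over all x, y with [val e = [set x; y]]; counting elements rules out
    the collapsed case x = y. *)
Lemma edge_pair_neq (G : sgraph) (x y : G) :
  [set x; y] \in edges G -> x != y.
Proof.
case/edgesP=> a [b [/adj_neq ab Exy]]; have := cards2 x y.
by rewrite Exy cards2 ab; case: eqP.
Qed.

Lemma card_edge (G : sgraph) : #|edge G| = #|edges G|.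
Proof. by rewrite card_sig. Qed.

(** * Super edge-magic labelings and vertex numberings *)

Lemma inj_range_surj (T : finType) (f : T -> nat) (a : nat) :
  injective f -> (forall x, a <= f x < a + #|T|) ->
  forall k, (exists x, f x = k) <-> a <= k < a + #|T|.
Proof.
move=> f_inj f_range k; split=> [[x <-] //|k_range].
(* Pigeonhole: the values form a duplicate-free list inside an interval of the same length. *)
have fs : {subset map f (enum T) <= iota a #|T|}.
  by move=> j /mapP[x _ ->]; rewrite mem_iota.
have us : uniq (map f (enum T)) by rewrite map_inj_uniq ?enum_uniq.
have [|_ E] := uniq_min_size us fs.
  by rewrite size_iota size_map -cardE.
have: k \in map f (enum T) by rewrite E mem_iota.
by case/mapP=> x _ ->; exists x.
Qed.

(** An edge of sum a gets the label p + s + q - a. As a runs through s, ..., s+q-1, these labels run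
    down from p+q to p+1, and the magic constant is p + s + q. *)
Lemma super_edge_magic_of_edge_sums (G : sgraph) (g : G -> nat) (s : nat) :
  injective g -> (forall x, 1 <= g x <= #|G|) ->
  {in edges G &, injective (edge_sum g)} ->
  {in edges G, forall e, s <= edge_sum g e < s + #|edges G|} ->
  super_edge_magic G.
Proof.
move=> g_inj g_range s_inj s_range.
pose es (e : edge G) := edge_sum g (val e).
pose f (z : G + edge G) := match z with
  | inl x => g x
  | inr e => #|G| + (s + #|edges G| - es e) end.
have e_range (e : edge G) : s <= es e < s + #|edges G|.
  exact: s_range (valP e).
have f_inj : injective f.
  move=> [x|e] [y|e']; rewrite /f => E.
  - by rewrite (g_inj _ _ E).
  - by exfalso; have := g_range x; have := e_range e'; lia.
  - by exfalso; have := g_range y; have := e_range e; lia.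
  - have := e_range e; have := e_range e' => h h'.
    congr inr; apply: val_inj; apply: s_inj; try exact: valP.
    by change (es e = es e'); lia.
exists f; split=> //.
- move=> k; have H z : 1 <= f z < 1 + #|{: G + edge G}|.
    rewrite card_sum card_edge; case: z => [x|e]; rewrite /f; first by have := g_range x; lia.
    by have := e_range e; lia.
  by rewrite (inj_range_surj f_inj H) card_sum card_edge add1n ltnS.
- by move=> k; rewrite (inj_range_surj g_inj (a := 1)) // add1n.
exists (#|G| + s + #|edges G|) => x y e E.
have xy : x != y by apply: edge_pair_neq; rewrite -E; apply: valP.
have := e_range e; rewrite /f /es E edge_sum_pair //; lia.
Qed.

(** An edge label is the constant minus the edge sum, so distinct edges have distinct sums. These
    lie between 1+2 and (p-1)+p, which leaves 2p-3 values. For p <= 1 the inequality is false. *)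
Lemma super_edge_magic_card_edges (G : sgraph) :
  1 < #|G| -> super_edge_magic G -> #|edges G| + 3 <= 2 * #|G|.
Proof.
move=> G_gt1 [f [f_inj _ f_vert [c f_sum]]].
pose g x := f (inl x).
have g_range x : 1 <= g x <= #|G| by apply/f_vert; exists x.
have pair_range x y : x != y -> 3 <= g x + g y < 2 * #|G|.
  move=> xy; have := g_range x; have := g_range y.
  have: g x != g y by apply: contra_neq xy => /f_inj[].
  lia.
have e_range (e : edge G) : 3 <= edge_sum g (val e) < 2 * #|G|.
  have /edgesP[x [y [/adj_neq xy ->]]] := valP e.
  by rewrite edge_sum_pair // pair_range.
have e_sum (e : edge G) : edge_sum g (val e) + f (inr e) = c.
  have /edgesP[x [y [/adj_neq xy E]]] := valP e.
  by rewrite E edge_sum_pair // -(f_sum x y e E) addnAC.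
have e_inj : injective (fun e : edge G => edge_sum g (val e)).
  move=> e e' /= E; have := e_sum e.
  by rewrite -(e_sum e') E => /addnI/f_inj[].
have us : uniq [seq edge_sum g (val e) | e <- enum {: edge G}].
  by rewrite map_inj_uniq ?enum_uniq.
have ss : {subset [seq edge_sum g (val e) | e <- enum {: edge G}]
             <= iota 3 (2 * #|G| - 3)}.
  by move=> k /mapP[e _ ->]; rewrite mem_iota subnKC ?e_range //; lia.
have := uniq_leq_size us ss; rewrite size_iota size_map -cardE card_edge; lia.
Qed.

(** * Adding isolated vertices *)

Lemma edges_isolated (G : sgraph) (t : nat) :
  edges (disjoint_union G (empty_graph t)) =
  [set [set inl x | x in e] | e : {set G} in edges G].
Proof.
apply/setP=> e; apply/edgesP/imsetP => [[[x|x] [[y|y] [//= xy ->]]]|].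
  by exists [set x; y]; [exact: mem_edges | rewrite imsetU1 imset_set1].
case=> _ /edgesP[x [y [xy ->]]] ->.
by exists (inl x), (inl y); rewrite imsetU1 imset_set1.
Qed.

Lemma inj_imset_inl (A B : finType) :
  injective (fun e : {set A} => [set (inl x : A + B) | x in e]).
Proof. by apply: imset_inj => x y []. Qed.

Lemma card_edges_isolated (G : sgraph) (t : nat) :
  #|edges (disjoint_union G (empty_graph t))| = #|edges G|.
Proof. by rewrite edges_isolated card_imset //; apply: inj_imset_inl. Qed.

(** The isolated vertices take the values that [g] leaves free; there are exactly t of them. *)
Lemma extend_numbering (T : finType) (t : nat) (g : T -> nat) :
  injective g -> (forall x, 1 <= g x <= #|T| + t) ->
  exists h : T + 'I_t -> nat,
    [/\ injective h, forall z, 1 <= h z <= #|T| + t & forall x, h (inl x) = g x].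
Proof.
move=> g_inj g_range; pose used := map g (enum T).
pose free := [seq k <- iota 1 (#|T| + t) | k \notin used].
have us : uniq used by rewrite map_inj_uniq ?enum_uniq.
have free_size : size free = t.
  have pE : perm_eq [seq k <- iota 1 (#|T| + t) | k \in used] used.
    apply: uniq_perm; rewrite ?filter_uniq ?iota_uniq // => k.
    rewrite mem_filter mem_iota; case: (boolP (k \in used)) => //= /mapP[x _ ->].
    by rewrite ltnS g_range.
  have := count_predC (mem used) (iota 1 (#|T| + t)).
  rewrite -!size_filter (perm_size pE) size_map -cardE size_iota.
  by move/addnI.
pose h (z : T + 'I_t) := match z with inl x => g x | inr i => nth 0 free i end.
have h_free i : h (inr i) \in free by rewrite mem_nth // free_size.
have h_used x : h (inl x) \in used by apply/mapP; exists x; rewrite ?mem_enum.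
have free_used k : k \in free -> k \notin used by rewrite mem_filter => /andP[].
exists h; split=> //.
  move=> [x|i] [y|j] E.
  - by rewrite (g_inj _ _ E).
  - by have := free_used _ (h_free j); rewrite -E h_used.
  - by have := free_used _ (h_free i); rewrite E h_used.
  - move/eqP: E; rewrite /= nth_uniq ?free_size ?filter_uniq ?iota_uniq //.
    by move/eqP/val_inj->.
move=> [x|i]; first exact: g_range.
by have := h_free i; rewrite mem_filter mem_iota; lia.
Qed.

(** Isolated vertices enter no edge sum, so a numbering of G with gaps is enough. *)
Lemma sem_with_isolated_of_edge_sums (G : sgraph) (t : nat) (g : G -> nat)
    (s : nat) :
  injective g -> (forall x, 1 <= g x <= #|G| + t) ->
  {in edges G &, injective (edge_sum g)} ->
  {in edges G, forall e, s <= edge_sum g e < s + #|edges G|} ->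
  sem_with_isolated G t.
Proof.
move=> g_inj g_range s_inj s_range; apply/asboolP.
have [h [h_inj h_range hE]] := extend_numbering g_inj g_range.
have sumE (e : {set G}) :
    @edge_sum (disjoint_union G (empty_graph t)) h [set inl x | x in e]
    = edge_sum g e.
  rewrite /edge_sum big_imset /=; last by move=> x y _ _ [].
  by apply: eq_bigr => x _; rewrite hE.
apply: (@super_edge_magic_of_edge_sums (disjoint_union G (empty_graph t)) h s).
- exact: h_inj.
- by move=> x; rewrite card_sum card_ord.
- rewrite edges_isolated => _ _ /imsetP[e eG ->] /imsetP[e' e'G ->].
  by rewrite !sumE => /s_inj->.
- rewrite card_edges_isolated edges_isolated => _ /imsetP[e eG ->].
  by rewrite sumE s_range.
Qed.

Lemma sem_with_isolated_lower_bound (G : sgraph) (t : nat) :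
  1 < #|G| -> sem_with_isolated G t -> #|edges G| + 3 <= 2 * (#|G| + t).
Proof.
move=> G_gt1 /asboolP/super_edge_magic_card_edges.
rewrite card_edges_isolated card_sum card_ord; apply.
exact: leq_trans (leq_addr _ _).
Qed.

(** * The numbering of the join and its edge sums *)

Section PathJoinEmpty.

Variables n m : nat.
Hypotheses (n_ge3 : 3 <= n) (m_ge3 : 3 <= m).

Let G := join_graph (path_graph n) (empty_graph m).

(** Indices start at 0. Even path positions get n./2 + 1, ..., n and odd ones n + 1, ..., n +
    n./2. *)
Definition path_empty_label (x : G) : nat :=
  match x with
  | inl i => if odd i then n + uphalf i else n./2 + i./2 + 1
  | inr j => if j == 0 :> nat then 1 else n * j.+1
  end.

(** Orients each path edge upwards and each cross edge from the path, which halves the later case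
    analysis. *)
Lemma path_empty_edgeP (e : {set G}) :
  e \in edges G ->
  (exists (i j : 'I_n), i.+1 = j :> nat /\ e = [set inl i; inl j])
  \/ (exists (i : 'I_n) (j : 'I_m), e = [set inl i; inr j]).
Proof.
case/edgesP=> [[i|i] [[j|j] [//= ij ->]]].
- case/orP: ij => /eqP ij; first by left; exists i, j.
  by left; exists j, i; rewrite setUC.
- by right; exists i, j.
- by right; exists j, i; rewrite setUC.
Qed.

Lemma path_empty_label_inl_inj (i i' : 'I_n) :
  path_empty_label (inl i) = path_empty_label (inl i') -> i = i'.
Proof.
have := ltn_ord i; have := ltn_ord i' => /= ? ?.
move=> E; apply: val_inj => /=; move: E.
by case: ifP; case: ifP; lia.
Qed.

Lemma path_empty_label_inl_range (i : 'I_n) :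
  n./2 < path_empty_label (inl i) <= n./2 + n.
Proof. by have := ltn_ord i; rewrite /=; case: ifP; lia. Qed.

Lemma path_empty_label_inr_range (j : 'I_m) :
  1 <= path_empty_label (inr j) <= n * m.
Proof. by have := ltn_ord j; rewrite /=; case: ifP; nia. Qed.

(** The label 1 is at most n./2 since n >= 3; all others are at least 2n. *)
Lemma path_empty_label_inr_outside (j : 'I_m) :
  path_empty_label (inr j) <= n./2 \/ n./2 + n < path_empty_label (inr j).
Proof. by rewrite /=; case: ifP => h; [left|right]; nia. Qed.

Lemma path_empty_label_inj : injective path_empty_label.
Proof.
move=> [i|j] [i'|j'] E.
- by rewrite (path_empty_label_inl_inj E).
- exfalso; have := path_empty_label_inl_range i; have := path_empty_label_inr_outside j'.
  by rewrite -E; move: (path_empty_label _) => a; lia.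
- exfalso; have := path_empty_label_inl_range i'; have := path_empty_label_inr_outside j.
  by rewrite E; move: (path_empty_label _) => a; lia.
- congr inr; apply: val_inj; move: E => /=; case: ifP; case: ifP; nia.
Qed.

Lemma path_empty_label_range (x : G) : 1 <= path_empty_label x <= n * m.
Proof.
case: x => [i|j]; last exact: path_empty_label_inr_range.
have: n * 3 <= n * m by rewrite leq_mul2l m_ge3 orbT.
by have := path_empty_label_inl_range i; move: (path_empty_label _) => a; lia.
Qed.

(** Moving one edge along the path replaces an endpoint by the next label of the same half, so the
    sum grows by 1. *)
Lemma path_empty_label_step (i j : 'I_n) :
  i.+1 = j :> nat ->
  path_empty_label (inl i) + path_empty_label (inl j) = n./2 + n + 2 + i.
Proof. by move=> ij; rewrite /= -ij; case: ifP; case: ifP; lia. Qed.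

Lemma path_empty_sum_step (i j : 'I_n) :
  i.+1 = j :> nat ->
  edge_sum path_empty_label [set inl i; inl j] = n./2 + n + 2 + i.
Proof.
move=> ij; rewrite edge_sum_pair ?path_empty_label_step //.
by apply/eqP=> -[E]; move: ij; rewrite E; lia.
Qed.

Lemma path_empty_sum_cross (i : 'I_n) (j : 'I_m) :
  edge_sum path_empty_label [set inl i; inr j] =
  path_empty_label (inl i) + path_empty_label (inr j).
Proof. exact: edge_sum_pair. Qed.

Lemma path_empty_sum_inj : {in edges G &, injective (edge_sum path_empty_label)}.
Proof.
(* Path sums end at n./2 + 2n: above all sums at label 1, below all sums at labels 2n and more. *)
have step_cross (i i' : 'I_n) (k : 'I_n) (j : 'I_m) : i.+1 = i' :> nat ->
    n./2 + n + 2 + i <> path_empty_label (inl k) + path_empty_label (inr j).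
  have := path_empty_label_inl_range k; have := ltn_ord i'.
  by move: (path_empty_label (inl k)) => a /=; case: ifP; nia.
have cross_cross (i i' : 'I_n) (j j' : 'I_m) :
    path_empty_label (inl i) + path_empty_label (inr j) =
    path_empty_label (inl i') + path_empty_label (inr j') -> i = i' /\ j = j'.
  (* Path labels lie in a window of n integers, while two labels of the empty part differ by at
     least n; so the sum determines j. *)
  move=> E; suff jj : j = j'.
    by split=> //; apply: path_empty_label_inl_inj; move: E; rewrite jj => /addIn.
  apply: val_inj; have := path_empty_label_inl_range i.
  have := path_empty_label_inl_range i'; move: E.
  move: (path_empty_label (inl i)) (path_empty_label (inl i')) => a a' /=.
  by case: ifP; case: ifP; nia.
move=> e e' /path_empty_edgeP eP /path_empty_edgeP e'P.
case: eP => [[i [j [ij ->]]]|[i [j ->]]];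
  case: e'P => [[i' [j' [ij' ->]]]|[i' [j' ->]]];
  rewrite ?path_empty_sum_step ?path_empty_sum_cross // => E.
- have ii : i = i' by apply: val_inj => /=; lia.
  have jj : j = j' by apply: val_inj; rewrite /= -ij -ij' ii.
  by rewrite ii jj.
- by case: (step_cross _ _ _ _ ij E).
- by case: (step_cross _ _ _ _ ij' (esym E)).
- by have [-> ->] := cross_cross _ _ _ _ E.
Qed.

(** An injection of cross pairs and path steps into the edges. Both bounds on the deficiency use q
    from below. *)
Lemma path_empty_card_edges : n * m + n.-1 <= #|edges G|.
Proof.
pose wid (i : 'I_n.-1) : 'I_n := widen_ord (leq_pred n) i.
(* The default [wid i] is never taken, since i + 1 < n. *)
pose nxt (i : 'I_n.-1) : 'I_n := insubd (wid i) i.+1.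
pose ends (z : 'I_n * 'I_m + 'I_n.-1) : {set G} := match z with
  | inl p => [set inl p.1; inr p.2]
  | inr i => [set inl (wid i); inl (nxt i)] end.
have nxtE i : nxt i = i.+1 :> nat.
  by rewrite val_insubd; have := ltn_ord i; case: ifP => //; lia.
(* Position a is an endpoint of step b, hence b or b + 1; exchanging the roles then gives
   equality. *)
have ends_le (a b : 'I_n.-1) : ends (inr a) = ends (inr b) -> b <= a.
  move=> E; have : inl (wid a) \in ends (inr b) by rewrite -E set21.
  pose pos (x : G) := if x is inl k then val k else 0.
  by case/set2P=> /(congr1 pos) /=; rewrite ?nxtE => ->.
have ends_inj : injective ends.
  move=> [[i j]|i] [[i' j']|i'] /= E.
  - have /set2P[[->]|//] : inl i \in [set inl i'; inr j'] by rewrite -E set21.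
    by have /set2P[//|[->]] : inr j \in [set inl i'; inr j'] by rewrite -E set22.
  - by have := set22 (inl i) (inr j); rewrite E => /set2P[].
  - by have := set22 (inl i') (inr j'); rewrite -E => /set2P[].
  - by congr inr; apply/val_inj/eqP; rewrite eqn_leq !ends_le.
have sub : [set ends z | z : _] \subset edges G.
  apply/subsetP=> _ /imsetP[[[i j]|i] _ ->]; apply: mem_edges => //=.
  by rewrite /path_rel nxtE eqxx.
have := subset_leq_card sub.
by rewrite card_imset // card_sum card_prod !card_ord.
Qed.

Lemma path_empty_card : #|G| = n + m.
Proof. by rewrite card_sum !card_ord. Qed.

(** The largest label is nm, and nm - (n + m) = (n-1)(m-1) - 1. *)
Lemma path_empty_sem_with_isolated :
  sem_with_isolated G (n.-1 * m.-1).-1.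
Proof.
(* The least sum joins label 1 to the least path label n./2 + 1. *)
apply: (@sem_with_isolated_of_edge_sums _ _ path_empty_label (n./2 + 2)).
- exact: path_empty_label_inj.
- move=> x; have := path_empty_label_range x; rewrite path_empty_card.
  by move: (path_empty_label x) => a; nia.
- exact: path_empty_sum_inj.
move=> e /path_empty_edgeP eP; have := path_empty_card_edges.
move: #|edges G| => q hq.
case: eP => [[i [j [ij ->]]]|[i [j ->]]].
  by rewrite path_empty_sum_step //; have := ltn_ord j; nia.
rewrite path_empty_sum_cross; have := path_empty_label_inl_range i.
have := path_empty_label_inr_range j.
by move: (path_empty_label _) (path_empty_label _) => a b; lia.
Qed.

(** From nm + n - 1 + 3 <= 2(n + m + t), expanded. *)
Lemma path_empty_deficiency_lower (t : nat) :
  sem_with_isolated G t -> (n - 2) * (m - 1) <= 2 * t.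
Proof.
move/sem_with_isolated_lower_bound; rewrite path_empty_card.
have := path_empty_card_edges; move: #|edges G| => q hq /(_ _); nia.
Qed.

End PathJoinEmpty.

(** * Transfer of the bounds to the extended integers *)

Import GRing.Theory Num.Theory.
Local Open Scope ring_scope.

Theorem theorem3 (n m : nat) (hn : (3 <= n)%N) (hm : (3 <= m)%N) :
  ((Num.ceil (1 / 2 * (n%:R - 2) * (m%:R - 1) : rat))%:E
     <= sem_deficiency (join_graph (path_graph n) (empty_graph m)))%E
  /\
  (sem_deficiency (join_graph (path_graph n) (empty_graph m))
     <= ((n%:Z - 1) * (m%:Z - 1) - 1)%:E)%E.
Proof.
have sem := path_empty_sem_with_isolated hn hm.
rewrite /sem_deficiency; case: pselect => [ex|[]]; last by exists (n.-1 * m.-1).-1%N.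
case: ex_minnP => t t_sem t_min; rewrite !lee_fin; split.
  have := path_empty_deficiency_lower hn hm t_sem.
  rewrite -(ler_nat rat) !natrM !natrB; try lia.
  (* The ceiling is at most the integer t exactly when its argument is, so halving takes place in
     the rationals. *)
  by rewrite ceil_le_int; move: (n%:R) (m%:R) => a b; lra.
by have := t_min _ sem; nia.
Qed.
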